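(* Let $K$ be a finite-dimensional Kac algebra obtained by twisting a group algebra $\mathbb{C}[G]$ with a 2-(pseudo)-cocycle $\Omega$ of a commutative subgroup $H$ of $G$. Then the coideal subalgebras of $K$ containing $H$ are in correspondence with the subgroups of $G$ containing $H$. Namely, the coideal subalgebra $I_{G'}$ corresponding to the subgroup $G'$ is obtained by twisting the group algebra $\mathbb{C}[G']\subset\mathbb{C}[G]$ with $\Omega$; in particular, its Jones projection is still $\frac1{|G'|}\sum_{g'\in G'}\lambda(g')$.
   Context: A finite-dimensional Kac algebra is a finite-dimensional $C^*$-algebra $K$ with a Hopf algebra structure $(\Delta,\varepsilon,S)$ for which $\Delta$ is a $*$-homomorphism. Twisting: $G$ is a finite group, $\lambda(g)$ is the canonical basis of $\mathbb{C}[G]$, $\Delta_s(\lambda(g))=\lambda(g)\otimes\lambda(g)$, and $H$ is a commutative subgroup. $\Omega$ is a unitary of $\mathbb{C}[H]\otimes\mathbb{C}[H]$ such that the $*$-algebra $\mathbb{C}[G]$ with the coproduct $\Delta(x)=\Omega\Delta_s(x)\Omega^*$ and the usual counit $\varepsilon(\lambda(g))=1$ is a Kac algebra $K$ (in particular $\Delta$ is coassociative); one says that $K$ is obtained by twisting $\mathbb{C}[G]$ with $\Omega$. A coideal subalgebra of $K$ is a unital $*$-subalgebra $I$ with $\Delta(I)\subset K\otimes I$; ''containing $H$'' means containing $\lambda(h)$ for all $h\in H$. The Jones projection $p_I$ of $I$ is the unique nonzero projection of $I$ such that $yp_I=\varepsilon(y)p_I$ for all $y\in I$. *)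

(* Defs.v *)
From HB Require Import structures.
From mathcomp Require Import all_boot all_order all_algebra all_fingroup.
Set Implicit Arguments.
Unset Strict Implicit.
Unset Printing Implicit Defensive.
Import GRing.Theory Num.Theory.
Local Open Scope ring_scope.

(* The group algebra C[X]: the element x stands for \sum_g x(g) lambda(g), and
   the product is the convolution.
   C[X] (x) C[Y] is identified throughout with C[X * Y] through
   lambda(g) (x) lambda(h) = lambda(g, h); this is an isomorphism of unital
   *-algebras, so the ring structure and [gstar] below, used on the finite
   group X * Y, are those of the tensor product. *)
Definition galg (C : numClosedFieldType) (X : finGroupType) : Type :=
  {ffun X -> C^o}.

Section GroupAlgebra.
Variables (C : numClosedFieldType) (X : finGroupType).
Local Notation A := (galg C X).

HB.instance Definition _ := Vector.copy A {ffun X -> C^o}.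

Definition gmul (x y : A) : A :=
  [ffun g => \sum_(h : X) x h * y (h^-1 * g)%g].

Definition glam (g : X) : A := [ffun h => (h == g)%:R].

Fact gmulA : associative gmul.
Proof.
move=> x y z; apply/ffunP => g; rewrite !ffunE.
under eq_bigr => h _ do rewrite ffunE mulr_sumr.
under [RHS]eq_bigr => h _ do rewrite ffunE mulr_suml.
rewrite [RHS]exchange_big /=; apply: eq_bigr => h _.
rewrite [RHS](reindex_inj (mulgI h)) /=; apply: eq_bigr => k _.
by rewrite mulKg invMg mulgA mulrA.
Qed.

Fact gmul1l : left_id (glam 1%g) gmul.
Proof.
move=> x; apply/ffunP => g; rewrite ffunE (bigD1 1%g) //= big1 => [|h /negbTE h1].
  by rewrite ffunE eqxx invg1 mul1g mul1r addr0.
by rewrite ffunE h1 mul0r.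
Qed.

Fact gmul1r : right_id (glam 1%g) gmul.
Proof.
move=> x; apply/ffunP => g; rewrite ffunE (bigD1 g) //= big1 => [|h /negbTE h1].
  by rewrite ffunE mulVg eqxx mulr1 addr0.
by rewrite ffunE -eq_mulVg1 h1 mulr0.
Qed.

Fact gmulDl : left_distributive gmul +%R.
Proof.
move=> x y z; apply/ffunP => g; rewrite !ffunE -big_split /=.
by apply: eq_bigr => h _; rewrite !ffunE mulrDl.
Qed.

Fact gmulDr : right_distributive gmul +%R.
Proof.
move=> x y z; apply/ffunP => g; rewrite !ffunE -big_split /=.
by apply: eq_bigr => h _; rewrite !ffunE mulrDr.
Qed.

Fact glam1_neq0 : glam 1%g != 0.
Proof.
by apply/eqP => /ffunP/(_ 1%g)/eqP; rewrite !ffunE eqxx oner_eq0.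
Qed.

HB.instance Definition _ := GRing.Zmodule_isNzRing.Build A
  gmulA gmul1l gmul1r gmulDl gmulDr glam1_neq0.

Fact gscaleAl (a : C) (x y : A) : a *: (x * y) = (a *: x) * y.
Proof.
apply/ffunP => g; rewrite !ffunE scaler_sumr.
by apply: eq_bigr => h _; rewrite ffunE scalerAl.
Qed.

HB.instance Definition _ := GRing.Lmodule_isLalgebra.Build C A gscaleAl.

Fact gscaleAr (a : C) (x y : A) : a *: (x * y) = x * (a *: y).
Proof.
apply/ffunP => g; rewrite !ffunE scaler_sumr.
by apply: eq_bigr => h _; rewrite ffunE scalerAr.
Qed.

HB.instance Definition _ := GRing.Lalgebra_isAlgebra.Build C A gscaleAr.

Definition gstar (x : A) : A := [ffun g => (x g^-1%g)^*].

Definition gcounit (x : A) : C := \sum_(g : X) x g.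

(* C[G], as a subspace of C[X], for a subgroup G of X. *)
Definition gsub (G : {group X}) : {vspace A} :=
  <<[seq glam g | g <- enum G]>>%VS.

(* A C*-norm; in finite dimension completeness is automatic. The values are
   nonnegative reals, seen in C. *)
Record cstar_norm (N : A -> C) : Prop := {
  cstar_ge0 : forall x, 0 <= N x;
  cstar_eq0 : forall x, N x = 0 -> x = 0;
  cstar_triangle : forall x y, N (x + y) <= N x + N y;
  cstar_scale : forall (a : C) x, N (a *: x) = `|a| * N x;
  cstar_submult : forall x y, N (x * y) <= N x * N y;
  cstar_identity : forall x, N (gstar x * x) = N x ^+ 2 }.

End GroupAlgebra.

Section Tensor.
Variable C : numClosedFieldType.

Definition gtens (X Y : finGroupType) (x : galg C X) (y : galg C Y) :
    galg C (X * Y)%type :=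
  [ffun p => x p.1 * y p.2].

(* The linear map C[X] (x) C[Y] -> V induced by the bilinear map b. *)
Definition tlift (X Y : finGroupType) (V : lmodType C)
    (b : galg C X -> galg C Y -> V) (t : galg C (X * Y)%type) : V :=
  \sum_(p : X * Y) t p *: b (glam C p.1) (glam C p.2).

(* The linear map C[X] -> C[Y] such that lambda(g) |-> lambda(f(g)). *)
Definition gmap (X Y : finGroupType) (f : X -> Y) (x : galg C X) : galg C Y :=
  \sum_(g : X) x g *: glam C (f g).

Definition tensv (X Y : finGroupType)
    (U : {vspace galg C X}) (V : {vspace galg C Y}) :
    {vspace galg C (X * Y)%type} :=
  <<[seq gtens x y | x <- vbasis U, y <- vbasis V]>>%VS.

End Tensor.

Section Kac.
Variables (C : numClosedFieldType) (X : finGroupType).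
Local Notation A := (galg C X).
Local Notation AA := (galg C (X * X)%type).

Definition tassoc (p : (X * X) * X) : X * (X * X) := (p.1.1, (p.1.2, p.2)).

(* S is an antipode for the coproduct D and the counit e. *)
Record antipode (D : A -> AA) (e : A -> C) (S : A -> A) : Prop := {
  antipode_linear : linear S;
  antipode_left : forall x, tlift (fun y z => S y * z) (D x) = e x *: 1;
  antipode_right : forall x, tlift (fun y z => y * S z) (D x) = e x *: 1 }.

(* The *-algebra C[X], with the coproduct D and the counit e, is a Kac
   algebra. *)
Record kac_algebra (D : A -> AA) (e : A -> C) : Prop := {
  kac_cstar : exists N : A -> C, cstar_norm N;
  kac_coprod_linear : linear D;
  kac_coprod_mult : monoid_morphism D;
  kac_coprod_star : forall x, D (gstar x) = gstar (D x);
  kac_counit_linear : scalar e;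
  kac_counit_mult : monoid_morphism e;
  kac_coassoc : forall x,
    gmap tassoc (tlift (fun y z => gtens (D y) z) (D x))
      = tlift (fun y z => gtens y (D z)) (D x);
  kac_counit_left : forall x, tlift (fun y z => e y *: z) (D x) = x;
  kac_counit_right : forall x, tlift (fun y z => e z *: y) (D x) = x;
  kac_antipode : exists S : A -> A, antipode D e S }.

Definition twist_coprod (W : AA) (x : A) : AA :=
  W * gmap (fun g => (g, g)) x * gstar W.

(* C[X] can be twisted by W, a 2-(pseudo)-cocycle of the commutative
   subgroup H. *)
Record twisting (H : {group X}) (W : AA) : Prop := {
  twisting_abelian : abelian H;
  twisting_supp : W \in tensv (gsub C H) (gsub C H);
  twisting_unitary : gstar W * W = 1 /\ W * gstar W = 1;
  twisting_kac : kac_algebra (twist_coprod W) (@gcounit C X) }.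

Record coideal_subalgebra (D : A -> AA) (I : {vspace A}) : Prop := {
  coideal_one : 1 \in I;
  coideal_mul : forall x y, x \in I -> y \in I -> x * y \in I;
  coideal_star : forall x, x \in I -> gstar x \in I;
  coideal_coprod : forall x, x \in I -> D x \in tensv fullv I }.

Definition contains_group (H : {group X}) (I : {vspace A}) : Prop :=
  forall h, h \in H -> glam C h \in I.

Record jones_projection (e : A -> C) (I : {vspace A}) (p : A) : Prop := {
  jones_mem : p \in I;
  jones_neq0 : p <> 0;
  jones_idem : p * p = p;
  jones_selfadj : gstar p = p;
  jones_counit : forall y, y \in I -> y * p = e y *: p }.

End Kac.

(* I is the image of C[G] in C[X], and the coproduct given by W on C[X]
   restricts on it to the coproduct of C[G] twisted by W, seen as an element of
   C[G] (x) C[G]; here G is turned into the finite group type [subg_of G], in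
   which H becomes [subg G @* H]. *)
Definition twisted_subgroup_algebra (C : numClosedFieldType)
    (X : finGroupType) (H G : {group X}) (W : galg C (X * X)%type)
    (I : {vspace galg C X}) : Prop :=
  let j := gmap (C := C) (@sgval X G) in
  let jj := gmap (C := C)
    (fun p : subg_of G * subg_of G => (sgval p.1, sgval p.2)) in
  exists W' : galg C (subg_of G * subg_of G)%type,
    [/\ jj W' = W,
        twisting (subg G @* H)%G W',
        forall x, x \in I <-> exists y, x = j y
      & forall y, twist_coprod W (j y) = jj (twist_coprod W' y)].

(* Main.v *)
Require Import Defs.
From HB Require Import structures.
From mathcomp Require Import all_boot all_order all_algebra all_fingroup.
From mathcomp Require Import reals complex.
Import GRing.Theory Num.Theory.
Local Open Scope ring_scope.
Local Open Scope complex_scope.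

(** The unitary Omega lies in the tensor square of C[H], so for every unital
    *-subalgebra I containing H both Omega and its adjoint lie in the
    *-algebra K (x) I. Hence the twisted coproduct
    D(x) = Omega D_s(x) Omega^* of x lies in K (x) I exactly when the
    untwisted one, D_s(x) = sum_g x(g) lambda(g) (x) lambda(g), does; and
    applying the coefficient functionals to the first leg, this happens exactly
    when every homogeneous component x(g) lambda(g) of x lies in I
    ([twist_coprod_tensv]). So the coideal subalgebras containing H are the
    *-subalgebras containing H that are spanned by the lambda(g) they contain,
    and those g form a subgroup: this is the correspondence.

    That C[G'] twisted by Omega is again a Kac algebra is the restriction of
    the structure of K along the injective *-morphism j : C[G'] -> C[G]
    ([kac_algebra_restrict]). All the identities follow from the injectivity of
    j and of its tensor powers. The antipode is the one existence statement
    which does not restrict formally, as an antipode S of K is not known to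
    preserve C[G']; but the restriction of functions from G to G' is a left
    inverse k of j and a map of C[G']-bimodules, so that k S j is an
    antipode.

    For the Jones projection, the average q of the elements of G' satisfies
    y q = eps(y) q = q y for y in C[G'], so that another Jones projection p is
    p = q p = eps(p) q, and p p = p forces eps(p) = 1. *)

Set Implicit Arguments.
Unset Strict Implicit.
Unset Printing Implicit Defensive.

(** * Group algebras and their subalgebras C[G] *)

Lemma span_ind (K : fieldType) (V : vectType K) (P : V -> Prop) (s : seq V) :
    P 0 -> (forall a u v, P u -> P v -> P (a *: u + v)) ->
    (forall v, v \in s -> P v) ->
  forall v, v \in <<s>>%VS -> P v.
Proof.
move=> P0 PD Ps v /(@coord_span _ _ _ (in_tuple s)) ->.
elim/big_rec: _ => // i w _ Pw; apply: PD => //; apply: Ps.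
exact: mem_nth (ltn_ord i).
Qed.

Section GroupAlgebra.
Variables (C : numClosedFieldType) (X : finGroupType).
Implicit Types (x y : galg C X) (g h : X) (G : {group X}).

Lemma galg_sum x : x = \sum_g x g *: glam C g.
Proof.
apply/ffunP => h; rewrite sum_ffunE (bigD1 h) //= big1 => [|g /negbTE gh].
  by rewrite !ffunE eqxx /= addr0 [LHS](esym (mulr1 _)).
by rewrite !ffunE eq_sym gh [LHS]mulr0.
Qed.

Lemma glam_mull g x h : (glam C g * x) h = x (g^-1 * h)%g.
Proof.
rewrite ffunE (bigD1 g) //= big1 => [|k /negbTE kg].
  by rewrite ffunE eqxx mul1r addr0.
by rewrite ffunE kg mul0r.
Qed.

Lemma glam_mulr g x h : (x * glam C g) h = x (h * g^-1)%g.
Proof.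
rewrite ffunE (bigD1 (h * g^-1)%g) //= big1 => [|k kg].
  by rewrite ffunE invMg invgK mulgKV eqxx mulr1 addr0.
rewrite ffunE; case: eqP => [e|_]; last by rewrite mulr0.
by rewrite -e invMg invgK mulKVg eqxx in kg.
Qed.

Lemma glamM g h : glam C g * glam C h = glam C (g * h)%g.
Proof.
apply/ffunP => k; rewrite glam_mull !ffunE.
by rewrite (can2_eq (mulKVg g) (mulKg g)).
Qed.

Fact gcounit_scalar : scalar (@gcounit C X).
Proof.
move=> a x y; rewrite /gcounit mulr_sumr -big_split /=.
by apply: eq_bigr => g _; rewrite !ffunE.
Qed.

HB.instance Definition _ :=
  GRing.isLinear.Build C (galg C X) C *%R (@gcounit C X) gcounit_scalar.

Lemma gcounit_glam g : gcounit (glam C g) = 1.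
Proof.
rewrite /gcounit (bigD1 g) //= big1 => [|h /negbTE hg].
  by rewrite ffunE eqxx addr0.
by rewrite ffunE hg.
Qed.

Lemma gsubP G x : x \in gsub C G <-> forall g, g \notin G -> x g = 0.
Proof.
split=> [xG g gG|xG]; last first.
  rewrite (galg_sum x); apply: memv_suml => g _.
  have [gG|/xG ->] := boolP (g \in G); last by rewrite scale0r mem0v.
  by rewrite memvZ // memv_span // map_f // mem_enum.
move: x xG; apply: span_ind => [|a u v u0 v0|v /mapP [h]].
- by rewrite ffunE.
- by rewrite !ffunE u0 v0 addr0 [LHS]mulr0.
- rewrite mem_enum => hG ->; rewrite ffunE.
  by case: eqP gG => // ->; rewrite hG.
Qed.

Lemma glam_gsub G g : (glam C g \in gsub C G) = (g \in G).
Proof.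
apply/idP/idP => [/gsubP gG|gG].
  apply: contraT => /gG /eqP; rewrite ffunE eqxx.
  by rewrite oner_eq0.
apply/gsubP => h hG; rewrite ffunE.
by case: eqP hG => // ->; rewrite gG.
Qed.

Lemma gsubT : gsub C [set: X]%G = fullv.
Proof.
by apply/vspaceP => x; rewrite memvf; apply/gsubP => g; rewrite inE.
Qed.

Lemma gsub_mul G x y : x \in gsub C G -> y \in gsub C G -> x * y \in gsub C G.
Proof.
move=> /gsubP xG /gsubP yG; apply/gsubP => g gG; rewrite ffunE big1 // => h _.
have [hG|/xG ->] := boolP (h \in G); last by rewrite mul0r.
by rewrite yG ?mulr0 // groupMl ?groupV.
Qed.

Lemma gsub_star G x : x \in gsub C G -> gstar x \in gsub C G.
Proof.
by move=> /gsubP xG; apply/gsubP => g gG; rewrite ffunE xG ?groupV ?conjC0.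
Qed.

End GroupAlgebra.

(** * Slices of tensors *)

(** The coefficient functional at [a] applied to the first leg. *)
Definition slice (C : numClosedFieldType) (X Y : finGroupType) (a : X)
  (t : galg C (X * Y)%type) : galg C Y := [ffun y => t (a, y)].

Section Slices.
Variables (C : numClosedFieldType) (X Y : finGroupType).
Implicit Types (t s : galg C (X * Y)%type) (V : {vspace galg C Y}).

Fact slice_linear (a : X) : linear (@slice C X Y a).
Proof. by move=> c s t; apply/ffunP => y; rewrite !ffunE. Qed.

HB.instance Definition _ a :=
  GRing.isLinear.Build C (galg C (X * Y)%type) (galg C Y) *:%R
    (@slice C X Y a) (slice_linear a).

Lemma slice_tens a (x : galg C X) (y : galg C Y) :
  slice a (gtens x y) = x a *: y.
Proof. by apply/ffunP => b; rewrite !ffunE. Qed.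

Lemma tens_slices t : t = \sum_a gtens (glam C a) (slice a t).
Proof.
apply/ffunP => -[a b]; rewrite sum_ffunE (bigD1 a) //= big1 => [|c /negbTE ca].
  by rewrite !ffunE eqxx mul1r addr0.
by rewrite !ffunE /= eq_sym ca mul0r.
Qed.

Lemma gtens_tensv (U : {vspace galg C X}) V (x : galg C X) (y : galg C Y) :
  x \in U -> y \in V -> gtens x y \in tensv U V.
Proof.
move=> xU yV.
have -> : gtens x y = \sum_i \sum_j
    (coord (vbasis U) i x * coord (vbasis V) j y)
      *: gtens (vbasis U)`_i (vbasis V)`_j.
  apply/ffunP => p; rewrite ffunE {1}(coord_vbasis xU) {1}(coord_vbasis yV).
  rewrite !sum_ffunE mulr_suml; apply: eq_bigr => i _.
  rewrite sum_ffunE mulr_sumr; apply: eq_bigr => j _.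
  by rewrite !ffunE [LHS]mulrACA.
apply: memv_suml => i _; apply: memv_suml => j _.
by rewrite memvZ // memv_span // allpairs_f // mem_nth // size_tuple.
Qed.

(** A tensor is the sum of the lambda(a) (x) t_a over its slices t_a, so
    belonging to C[G] (x) V is read off the slices alone. *)
Lemma tensv_gsubP (G : {group X}) V t :
  t \in tensv (gsub C G) V <->
  (forall a, slice a t \in V) /\ (forall a, a \notin G -> slice a t = 0).
Proof.
split=> [tGV|[tV tG]]; last first.
  rewrite (tens_slices t); apply: memv_suml => a _.
  have [aG|/tG ->] := boolP (a \in G).
    by rewrite gtens_tensv ?glam_gsub.
  suff -> : gtens (glam C a) 0 = 0 :> galg C (X * Y)%type by rewrite mem0v.
  by apply/ffunP => p; rewrite !ffunE mulr0.
move: t tGV; apply: span_ind => [|c u v [uV uG] [vV vG]|].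
- by split=> [a|a _]; rewrite linear0 ?mem0v.
- split=> [a|a aG]; rewrite linearP ?memvD ?memvZ //=.
  by rewrite uG // vG // scaler0 addr0.
move=> _ /allpairsP [[x y] [/= /vbasis_mem /gsubP xG /vbasis_mem yV ->]].
split=> [a|a aG]; rewrite slice_tens ?memvZ //.
by rewrite xG // scale0r.
Qed.

Lemma tensv_fullP V t :
  t \in tensv fullv V <-> forall a : X, slice a t \in V.
Proof.
rewrite -gsubT tensv_gsubP; split=> [[]|tV] //.
by split=> // a; rewrite inE.
Qed.

Lemma tensv_gsub_full (G : {group X}) V t :
  t \in tensv (gsub C G) V -> t \in tensv fullv V.
Proof. by case/tensv_gsubP => tV _; apply/tensv_fullP. Qed.

Lemma tensv_gsubs_supp (G : {group X}) (H : {group Y}) t :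
  t \in tensv (gsub C G) (gsub C H) <->
  forall p, ~~ ((p.1 \in G) && (p.2 \in H)) -> t p = 0.
Proof.
rewrite tensv_gsubP; split=> [[tH tG] [a b] /=|tGH].
  rewrite negb_and; case/orP => [/tG/ffunP/(_ b)|bH]; first by rewrite !ffunE.
  by have /gsubP/(_ b bH) := tH a; rewrite ffunE.
split=> [a|a aG].
  by apply/gsubP => b /negbTE bH; rewrite ffunE tGH //= bH andbF.
by apply/ffunP => b; rewrite !ffunE tGH //= (negbTE aG).
Qed.

Lemma slice_mul a s t :
  slice a (s * t) = \sum_b slice b s * slice (b^-1 * a)%g t.
Proof.
apply/ffunP => y; rewrite ffunE ffunE sum_ffunE.
under [RHS]eq_bigr => b _ do rewrite ffunE.
rewrite pair_bigA /=; apply: eq_bigr => -[b c] _.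
by rewrite !ffunE.
Qed.

Lemma slice_star a t : slice a (gstar t) = gstar (slice a^-1%g t).
Proof. by apply/ffunP => y; rewrite !ffunE. Qed.

Lemma tensv_full_mul V s t :
    (forall x y, x \in V -> y \in V -> x * y \in V) ->
  s \in tensv fullv V -> t \in tensv fullv V -> s * t \in tensv fullv V.
Proof.
move=> VM /tensv_fullP sV /tensv_fullP tV; apply/tensv_fullP => a.
by rewrite slice_mul memv_suml // => b _; apply: VM.
Qed.

Lemma tensv_full_star V t : (forall x, x \in V -> gstar x \in V) ->
  t \in tensv fullv V -> gstar t \in tensv fullv V.
Proof.
move=> VS /tensv_fullP tV; apply/tensv_fullP => a.
by rewrite slice_star; apply: VS.
Qed.

End Slices.

(** * Functoriality of the group algebra *)

Section Functoriality.
Variable C : numClosedFieldType.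

Fact gmap_linear (X Y : finGroupType) (f : X -> Y) : linear (@gmap C X Y f).
Proof.
move=> a x y; rewrite /gmap scaler_sumr -big_split /=.
by apply: eq_bigr => g _; rewrite !ffunE scalerDl scalerA.
Qed.

HB.instance Definition _ (X Y : finGroupType) (f : X -> Y) :=
  GRing.isLinear.Build C (galg C X) (galg C Y) *:%R (@gmap C X Y f)
    (gmap_linear f).

Fact tlift_linear (X Y : finGroupType) (V : lmodType C)
  (b : galg C X -> galg C Y -> V) : linear (tlift b).
Proof.
move=> a x y; rewrite /tlift scaler_sumr -big_split /=.
by apply: eq_bigr => g _; rewrite !ffunE scalerDl scalerA.
Qed.

HB.instance Definition _ (X Y : finGroupType) (V : lmodType C)
    (b : galg C X -> galg C Y -> V) :=
  GRing.isLinear.Build C (galg C (X * Y)%type) V *:%R (tlift b)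
    (tlift_linear b).

Lemma sum_glam (X : finGroupType) (V : lmodType C) (F : X -> V) g :
  \sum_h glam C g h *: F h = F g.
Proof.
rewrite (bigD1 g) //= big1 => [|h /negbTE hg].
  by rewrite ffunE eqxx scale1r addr0.
by rewrite ffunE hg scale0r.
Qed.

Lemma gmap_glam (X Y : finGroupType) (f : X -> Y) g :
  gmap f (glam C g) = glam C (f g).
Proof. exact: sum_glam. Qed.

Lemma tlift_glam (X Y : finGroupType) (V : lmodType C)
    (b : galg C X -> galg C Y -> V) p :
  tlift b (glam C p) = b (glam C p.1) (glam C p.2).
Proof. exact: sum_glam. Qed.

Lemma gmap_comp (X Y Z : finGroupType) (f : Y -> Z) (f' : X -> Y)
    (x : galg C X) : gmap f (gmap f' x) = gmap (f \o f') x.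
Proof.
rewrite [gmap f' x]/gmap linear_sum; apply: eq_bigr => g _.
by rewrite linearZ /= gmap_glam.
Qed.

Lemma linear_tlift (X Y : finGroupType) (V W : lmodType C)
    (F : {linear V -> W}) (b : galg C X -> galg C Y -> V) t :
  F (tlift b t) = tlift (fun y z => F (b y z)) t.
Proof. by rewrite /tlift linear_sum; apply: eq_bigr => p _; rewrite linearZ. Qed.

Lemma eq_tlift (X Y : finGroupType) (V : lmodType C)
    (b b' : galg C X -> galg C Y -> V) t :
  (forall y z, b y z = b' y z) -> tlift b t = tlift b' t.
Proof. by move=> e; apply: eq_bigr => p _; rewrite e. Qed.

(** [gmap (map_pair f f')] is the tensor product of [gmap f] and [gmap f']. *)
Definition map_pair (X Y X' Y' : finGroupType) (f : X -> X') (f' : Y -> Y')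
  (p : X * Y) : X' * Y' := (f p.1, f' p.2).

Lemma tlift_gmap (X Y X' Y' : finGroupType) (V : lmodType C)
    (f : X -> X') (f' : Y -> Y') (b : galg C X' -> galg C Y' -> V) t :
  tlift b (gmap (map_pair f f') t)
    = tlift (fun y z => b (gmap f y) (gmap f' z)) t.
Proof.
rewrite [gmap _ t]/gmap linear_sum; apply: eq_bigr => p _.
by rewrite linearZ /= tlift_glam !gmap_glam.
Qed.

Lemma gmap_tens (X Y X' Y' : finGroupType) (f : X -> X') (f' : Y -> Y')
    (x : galg C X) (y : galg C Y) :
  gmap (map_pair f f') (gtens x y) = gtens (gmap f x) (gmap f' y).
Proof.
apply/ffunP => -[a b]; rewrite [RHS]ffunE /= /gmap !sum_ffunE.
rewrite mulr_suml; under [RHS]eq_bigr => g _ do rewrite mulr_sumr.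
rewrite pair_bigA /=; apply: eq_bigr => -[g h] _; rewrite !ffunE /=.
by rewrite [RHS]mulrACA; congr (_ * _); rewrite -natrM mulnb.
Qed.

(** The restriction of functions along [f]; for an injective morphism of groups
    it plays the part of the conditional expectation onto the subalgebra. *)
Definition gres (X Y : finGroupType) (f : Y -> X) (x : galg C X) : galg C Y :=
  [ffun g => x (f g)].

Fact gres_linear (X Y : finGroupType) (f : Y -> X) : linear (gres f).
Proof. by move=> c s t; apply/ffunP => y; rewrite !ffunE. Qed.

HB.instance Definition _ (X Y : finGroupType) (f : Y -> X) :=
  GRing.isLinear.Build C (galg C X) (galg C Y) *:%R (gres f) (gres_linear f).

Lemma gresK (X Y : finGroupType) (f : Y -> X) (x : galg C X) :
    injective f -> (forall g, g \notin codom f -> x g = 0) ->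
  gmap f (gres f x) = x.
Proof.
move=> f_inj xf; apply/ffunP => g; rewrite /gmap sum_ffunE.
have [/codomP [h ->]|gf] := boolP (g \in codom f).
  rewrite (bigD1 h) //= big1 => [|k kh].
    by rewrite !ffunE eqxx addr0 [LHS]mulr1.
  by rewrite !ffunE (inj_eq f_inj) eq_sym (negbTE kh) [LHS]mulr0.
rewrite (xf _ gf) big1 // => h _; rewrite !ffunE.
by case: eqP gf => [->|_ _]; rewrite ?codom_f // [LHS]mulr0.
Qed.

Section Morphism.
Variables (X Y : finGroupType) (f : Y -> X).
Hypothesis f_mul : {morph f : g h / (g * h)%g}.

Let f1 : f 1%g = 1%g.
Proof. by apply: (mulgI (f 1%g)); rewrite -f_mul !mulg1. Qed.

Let fV g : f g^-1%g = (f g)^-1%g.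
Proof. by apply: (mulgI (f g)); rewrite -f_mul !mulgV f1. Qed.

Lemma gmap1 : gmap f 1 = 1 :> galg C X.
Proof. by rewrite [LHS]gmap_glam f1. Qed.

Lemma gmapM (x y : galg C Y) : gmap f (x * y) = gmap f x * gmap f y.
Proof.
rewrite (galg_sum x) mulr_suml !linear_sum mulr_suml; apply: eq_bigr => g _.
rewrite (galg_sum y) mulr_sumr !linear_sum mulr_sumr; apply: eq_bigr => h _.
rewrite -scalerAl -scalerAr !linearZ /= -scalerAl -scalerAr.
by rewrite glamM !gmap_glam glamM f_mul.
Qed.

Lemma gmap_star (x : galg C Y) : gmap f (gstar x) = gstar (gmap f x).
Proof.
apply/ffunP => g; rewrite ffunE /gmap !sum_ffunE rmorph_sum /=.
rewrite (reindex_inj invg_inj) /=; apply: eq_bigr => h _.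
rewrite !ffunE invgK [RHS]rmorphM /= conjC_nat fV.
by rewrite (can2_eq invgK invgK).
Qed.

Lemma gcounit_gmap (x : galg C Y) : gcounit (gmap f x) = gcounit x.
Proof.
rewrite /gmap linear_sum; apply: eq_bigr => g _.
by rewrite linearZ /= gcounit_glam mulr1.
Qed.

Lemma gres_mulr (x : galg C X) (y : galg C Y) :
  gres f (x * gmap f y) = gres f x * y.
Proof.
rewrite (galg_sum y) !linear_sum !mulr_sumr linear_sum; apply: eq_bigr => h _.
rewrite linearZ /= -!scalerAr linearZ /= gmap_glam; congr (_ *: _).
by apply/ffunP => g; rewrite ffunE !glam_mulr ffunE f_mul fV.
Qed.

Lemma gres_mull (x : galg C X) (y : galg C Y) :
  gres f (gmap f y * x) = y * gres f x.
Proof.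
rewrite (galg_sum y) !linear_sum !mulr_suml linear_sum; apply: eq_bigr => h _.
rewrite linearZ /= -!scalerAl linearZ /= gmap_glam; congr (_ *: _).
by apply/ffunP => g; rewrite ffunE !glam_mull ffunE f_mul fV.
Qed.

Hypothesis f_inj : injective f.

Lemma gmapK (x : galg C Y) : gres f (gmap f x) = x.
Proof.
apply/ffunP => g; rewrite ffunE /gmap sum_ffunE [in RHS](galg_sum x) sum_ffunE.
by apply: eq_bigr => h _; rewrite !ffunE (inj_eq f_inj).
Qed.

End Morphism.

Lemma gmap_inj (X Y : finGroupType) (f : Y -> X) :
  injective f -> injective (@gmap C Y X f).
Proof. by move=> f_inj; apply: can_inj (gmapK f_inj). Qed.

Lemma map_pair_inj (X Y X' Y' : finGroupType) (f : X -> X') (f' : Y -> Y') :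
  injective f -> injective f' -> injective (map_pair f f').
Proof. by move=> fI f'I [a b] [c d] [/fI -> /f'I ->]. Qed.

End Functoriality.

(** * Restricting a Kac algebra structure *)

Section Restriction.
Variables (C : numClosedFieldType) (X Y : finGroupType) (f : Y -> X).
Hypothesis f_mul : {morph f : g h / (g * h)%g}.
Hypothesis f_inj : injective f.
Local Notation j := (@gmap C Y X f).
Local Notation ff := (map_pair f f).
Local Notation jj := (@gmap C (Y * Y)%type (X * X)%type ff).

Let ff_mul : {morph ff : g h / (g * h)%g}.
Proof. by move=> [a b] [c d]; rewrite /map_pair /= !f_mul. Qed.

Let ff_inj : injective ff := map_pair_inj f_inj f_inj.

Let j_inj := @gmap_inj C _ _ _ f_inj.
Let jj_inj := @gmap_inj C _ _ _ ff_inj.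

Lemma cstar_norm_restrict (N : galg C X -> C) :
  cstar_norm N -> cstar_norm (fun y => N (j y)).
Proof.
case=> N0 Neq0 ND NZ NM NS; split=> //.
- by move=> y /Neq0 jy0; apply: j_inj; rewrite jy0 linear0.
- by move=> x y; rewrite linearD.
- by move=> a y; rewrite linearZ NZ.
- by move=> x y; rewrite gmapM.
- by move=> y; rewrite gmapM // gmap_star.
Qed.

(** The antipode equations are transported by [gres f], which is linear over
    the image of [j] on both sides. *)
Lemma antipode_restrict D D' (e : galg C X -> C) (S : galg C X -> galg C X) :
    (forall y, D (j y) = jj (D' y)) -> antipode D e S ->
  antipode D' (fun y => e (j y)) (fun y => gres f (S (j y))).
Proof.
move=> DD' [S_lin Sl Sr]; split=> [a x y|y|y].
- by rewrite linearP S_lin linearP.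
- apply: etrans (_ : gres f (e (j y) *: 1) = _); last first.
    by rewrite linearZ /= -(gmap1 C f_mul) gmapK.
  rewrite -Sl DD' tlift_gmap linear_tlift; apply: eq_tlift => u v /=.
  by rewrite gres_mulr.
- apply: etrans (_ : gres f (e (j y) *: 1) = _); last first.
    by rewrite linearZ /= -(gmap1 C f_mul) gmapK.
  rewrite -Sr DD' tlift_gmap linear_tlift; apply: eq_tlift => u v /=.
  by rewrite gres_mull.
Qed.

Lemma kac_algebra_restrict D D' (e : galg C X -> C) (e' : galg C Y -> C) :
    (forall y, D (j y) = jj (D' y)) -> e' =1 e \o j ->
  kac_algebra D e -> kac_algebra D' e'.
Proof.
move=> DD' ee' [[N Nstar] D_lin [D1 DM] D_star e_lin [e1 eM] D_assoc el er [S aS]].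
split.
- by exists (fun y => N (j y)); apply: cstar_norm_restrict.
- by move=> a x y; apply: jj_inj; rewrite -DD' linearP D_lin !DD' linearP.
- split; first by apply: jj_inj; rewrite -DD' !gmap1.
  by move=> x y; apply: jj_inj; rewrite -DD' !gmapM // DM !DD'.
- by move=> x; apply: jj_inj; rewrite -DD' !gmap_star // D_star DD'.
- by move=> a x y; rewrite !ee' /= linearP e_lin.
- by split=> [|x y]; rewrite !ee' /= ?gmap1 ?gmapM.
- move=> x; apply: (gmap_inj (map_pair_inj f_inj ff_inj)).
  (* reassociation commutes with the triple tensor power of [f] *)
  rewrite gmap_comp -[LHS]/(gmap (@tassoc X \o map_pair ff f) _) -gmap_comp.
  rewrite [gmap (map_pair ff f) _]linear_tlift.
  rewrite [gmap (map_pair f ff) _]linear_tlift.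
  rewrite (eq_tlift _ (b' := fun y z => gtens (D (j y)) (j z))); last first.
    by move=> y z; rewrite /= gmap_tens DD'.
  rewrite [RHS](eq_tlift _ (b' := fun y z => gtens (j y) (D (j z)))); last first.
    by move=> y z; rewrite /= gmap_tens DD'.
  by rewrite -(tlift_gmap f f (fun y z => gtens y (D z)))
             -(tlift_gmap f f (fun y z => gtens (D y) z)) -DD' D_assoc.
- move=> x; apply: j_inj; rewrite linear_tlift -[RHS]el DD' tlift_gmap.
  by apply: eq_tlift => y z; rewrite linearZ ee'.
- move=> x; apply: j_inj; rewrite linear_tlift -[RHS]er DD' tlift_gmap.
  by apply: eq_tlift => y z; rewrite linearZ ee'.
- exists (fun y => gres f (S (j y))).
  case: (antipode_restrict DD' aS) => S_lin Sl Sr.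
  by split=> // y; rewrite ?Sl ?Sr ee'.
Qed.

Lemma twist_coprod_restrict (W : galg C (Y * Y)%type) y :
  twist_coprod (jj W) (j y) = jj (twist_coprod W y).
Proof. by rewrite /twist_coprod !gmapM // gmap_star // !gmap_comp. Qed.

End Restriction.

(** * Coideal subalgebras containing H *)

Section Twisting.
Variables (C : numClosedFieldType) (X : finGroupType) (H : {group X}).
Variable W : galg C (X * X)%type.
Hypothesis tw : twisting H W.
Implicit Types (I : {vspace galg C X}) (G : {group X}).

Lemma slice_diag (x : galg C X) a :
  slice a (gmap (fun g => (g, g)) x) = x a *: glam C a.
Proof.
rewrite /gmap linear_sum (bigD1 a) //= big1 => [|g /negbTE ga]; last first.
  rewrite linearZ /= -[RHS](scaler0 _ (x g)); congr (_ *: _).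
  by apply/ffunP => h; rewrite !ffunE xpair_eqE eq_sym ga.
rewrite linearZ /= addr0; congr (_ *: _).
by apply/ffunP => h; rewrite !ffunE xpair_eqE eqxx.
Qed.

(** The *-algebra K (x) I contains the unitary W, so conjugation by W or by its
    adjoint preserves it and the twist can be undone; what remains is to slice
    the untwisted coproduct. *)
Lemma twist_coprod_tensv I :
    (forall x y, x \in I -> y \in I -> x * y \in I) ->
    (forall x, x \in I -> gstar x \in I) ->
    contains_group H I -> forall x,
  twist_coprod W x \in tensv fullv I <-> forall g, x g *: glam C g \in I.
Proof.
move=> IM IS HI x.
have [_ Wsupp [WsW WWs] _] := tw.
have WI : W \in tensv fullv I.
  have /tensv_fullP WH := tensv_gsub_full Wsupp.
  apply/tensv_fullP => a; rewrite (galg_sum (slice a W)).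
  apply: memv_suml => h _; have [hH|hH] := boolP (h \in H).
    by rewrite memvZ // HI.
  by have /gsubP -> := WH a; rewrite // scale0r mem0v.
have WsI := tensv_full_star IS WI.
have -> : (twist_coprod W x \in tensv fullv I)
    = (gmap (fun g => (g, g)) x \in tensv fullv I).
  apply/idP/idP => DI; last by apply: (tensv_full_mul IM (tensv_full_mul IM _ _) _).
  have -> : gmap (fun g => (g, g)) x = gstar W * twist_coprod W x * W.
    by rewrite /twist_coprod !mulrA WsW mul1r -mulrA WsW mulr1.
  by apply: (tensv_full_mul IM (tensv_full_mul IM _ _) _).
rewrite tensv_fullP.
by split=> xI a; have := xI a; rewrite slice_diag.
Qed.

Lemma gsub_coideal G : H \subset G ->
  coideal_subalgebra (twist_coprod W) (gsub C G) /\ contains_group H (gsub C G).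
Proof.
move=> /subsetP sHG.
have HG : contains_group H (gsub C G) by move=> h /sHG hG; rewrite glam_gsub.
split=> //; split.
- by rewrite [1]/(glam C 1%g) glam_gsub group1.
- exact: gsub_mul.
- exact: gsub_star.
move=> x /gsubP xG; apply/twist_coprod_tensv => // [||g].
- exact: gsub_mul.
- exact: gsub_star.
have [gG|/xG ->] := boolP (g \in G); last by rewrite scale0r mem0v.
by rewrite memvZ // glam_gsub.
Qed.

(** The homogeneous components x(g) lambda(g) of an element x of I lie in I, so
    I is spanned by the lambda(g) it contains. In a finite group, closure under
    products makes those g a subgroup. *)
Lemma coideal_gsub I :
    coideal_subalgebra (twist_coprod W) I -> contains_group H I ->
  exists! G : {group X}, H \subset G /\ I = gsub C G.
Proof.
move=> [I1 IM IS ID] HI.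
have homog x : x \in I -> forall g, x g *: glam C g \in I.
  by move/ID/(twist_coprod_tensv IM IS HI).
have Ggroup : group_set [set g | glam C g \in I].
  apply/group_setP; split=> [|g h]; rewrite !inE //.
  by move=> gI hI; rewrite -glamM IM.
exists (Group Ggroup); split; last first.
  by move=> G [_ IG]; apply/group_inj/setP => g; rewrite inE IG glam_gsub.
split; first by apply/subsetP => h hH; rewrite inE HI.
apply/vspaceP => x; apply/idP/idP => [xI|/gsubP xG].
  apply/gsubP => g; rewrite inE => gI; apply: contraNeq gI => xg0.
  by have := homog x xI g; rewrite rpredZeq (negbTE xg0).
rewrite (galg_sum x); apply: memv_suml => g _.
have [gI|gI] := boolP (glam C g \in I); first by rewrite memvZ.
by rewrite xG ?inE // scale0r mem0v.
Qed.

(** Being supported on H x H, W is the image of its restriction to G x G; the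
    structure of the twisted C[X] then restricts to C[G]. *)
Lemma gsub_twisted G : H \subset G -> twisted_subgroup_algebra H G W (gsub C G).
Proof.
move=> /subsetP sHG.
have [Hab Wsupp [WsW WWs] Wkac] := tw.
pose f := @sgval X G.
have f_mul : {morph f : g h / (g * h)%g} by [].
have f_inj : injective f by apply: val_inj.
have f_codom g : g \in G -> g \in codom f.
  by move=> gG; rewrite -(subgK _ gG) codom_f.
pose ff := map_pair f f.
have ff_mul : {morph ff : g h / (g * h)%g} by [].
have ff_inj : injective ff := map_pair_inj f_inj f_inj.
have /tensv_gsubs_supp W0 := Wsupp.
pose W' := gres ff W.
have jjW' : gmap ff W' = W.
  apply: gresK => // -[a b] ab; apply: W0; apply: contra ab => /= /andP[aH bH].
  have /codomP [u ->] := f_codom a (sHG a aH).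
  have /codomP [v ->] := f_codom b (sHG b bH).
  exact: (codom_f ff (u, v)).
have DD' y : twist_coprod W (gmap f y) = gmap ff (twist_coprod W' y).
  by rewrite -twist_coprod_restrict // jjW'.
exists W'; split=> //.
- split.
  + exact: morphim_abelian.
  + apply/tensv_gsubs_supp => -[u v] /= uvH; rewrite ffunE; apply: W0 => /=.
    have fH w : f w \in H -> w \in (subg G @* H)%G.
      by move=> wH; rewrite -(sgvalK w) mem_morphim ?subgP.
    by apply: contra uvH => /andP[/fH -> /fH ->].
  + split; apply: (gmap_inj ff_inj);
      by rewrite gmapM // gmap_star // jjW' gmap1.
  + apply: kac_algebra_restrict DD' _ Wkac => // y.
    by rewrite /= gcounit_gmap.
- move=> x; split=> [/gsubP xG|[y ->]].
    exists (gres f x); rewrite gresK // => g gf; apply: xG.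
    by apply: contra gf; apply: f_codom.
  by apply: memv_suml => g _; rewrite memvZ // glam_gsub subgP.
Qed.

End Twisting.

(** * Jones projections *)

Section Jones.
Variables (C : numClosedFieldType) (X : finGroupType) (G : {group X}).
Local Notation q := ((#|G|%:R)^-1 *: \sum_(g in G) glam C g).

Let card_neq0 : #|G|%:R != 0 :> C.
Proof. by rewrite pnatr_eq0 -lt0n cardG_gt0. Qed.

Lemma average_mem : q \in gsub C G.
Proof. by rewrite memvZ // memv_suml // => g gG; rewrite glam_gsub. Qed.

Lemma average_counit : gcounit q = 1.
Proof.
rewrite linearZ linear_sum /=.
under eq_bigr => g _ do rewrite gcounit_glam.
by rewrite sumr_const mulVf.
Qed.

Lemma average_mull y : y \in gsub C G -> y * q = gcounit y *: q.
Proof.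
move=> /gsubP yG; rewrite {1}(galg_sum y) mulr_suml scaler_suml.
apply: eq_bigr => g _; rewrite -scalerAl.
have [gG|/yG ->] := boolP (g \in G); last by rewrite !scale0r.
congr (_ *: _); rewrite -scalerAr mulr_sumr; congr (_ *: _).
rewrite [RHS](reindex_inj (mulgI g)) /=; apply: eq_big => [h|h _].
  by rewrite groupMl.
by rewrite glamM.
Qed.

Lemma average_mulr y : y \in gsub C G -> q * y = gcounit y *: q.
Proof.
move=> /gsubP yG; rewrite {1}(galg_sum y) mulr_sumr scaler_suml.
apply: eq_bigr => g _; rewrite -scalerAr.
have [gG|/yG ->] := boolP (g \in G); last by rewrite !scale0r.
congr (_ *: _); rewrite -scalerAl mulr_suml; congr (_ *: _).
rewrite [RHS](reindex_inj (mulIg g)) /=; apply: eq_big => [h|h _].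
  by rewrite groupMr.
by rewrite glamM.
Qed.

Lemma average_star : gstar q = q.
Proof.
apply/ffunP => g; rewrite !ffunE !sum_ffunE [LHS]rmorphM /= fmorphV rmorph_nat.
congr (_ * _); rewrite rmorph_sum (reindex_inj invg_inj) /=.
apply: eq_big => [h|h _]; first by rewrite groupV.
by rewrite !ffunE conjC_nat (inj_eq invg_inj).
Qed.

(** Uniqueness comes from computing q p in two ways: it is eps(q) p = p since p
    is a Jones projection, and eps(p) q since q absorbs C[G] on the right. *)
Lemma jones_projection_average p :
  jones_projection (@gcounit C X) (gsub C G) p <-> p = q.
Proof.
split=> [[pG p0 pp _ yp]|->].
  have pE : p = gcounit p *: q.
    by rewrite -average_mulr // yp ?average_mem // average_counit scale1r.
  suff ep : gcounit p = 1 by rewrite pE ep scale1r.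
  have := yp _ pG; rewrite pp => /eqP; rewrite -subr_eq0 -{1}[p]scale1r.
  rewrite -scalerBl scaler_eq0 => /orP[|/eqP //].
  by rewrite subr_eq0 eq_sym => /eqP.
split.
- exact: average_mem.
- move=> q0; have := average_counit; rewrite q0 linear0.
  by move/eqP; rewrite eq_sym oner_eq0.
- by rewrite average_mull ?average_mem // average_counit scale1r.
- exact: average_star.
- exact: average_mull.
Qed.

End Jones.

Theorem theorem5p4p1 (R : realType) (gT : finGroupType) (H : {group gT})
    (Omega : galg R[i] (gT * gT)%type) :
  twisting H Omega ->
  [/\ forall G' : {group gT}, H \subset G' ->
        coideal_subalgebra (twist_coprod Omega) (gsub R[i] G') /\
        contains_group H (gsub R[i] G'),
      forall I : {vspace galg R[i] gT},
        coideal_subalgebra (twist_coprod Omega) I -> contains_group H I ->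
        exists! G' : {group gT}, H \subset G' /\ I = gsub R[i] G',
      forall G' : {group gT}, H \subset G' ->
        twisted_subgroup_algebra H G' Omega (gsub R[i] G')
    & forall G' : {group gT}, H \subset G' ->
        forall p : galg R[i] gT,
          jones_projection (@gcounit R[i] gT) (gsub R[i] G') p <->
          p = (#|G'|%:R)^-1 *: \sum_(g in G') glam R[i] g ].
Proof.
move=> tw; split.
- exact: gsub_coideal.
- exact: coideal_gsub.
- exact: gsub_twisted.
- by move=> G' _; apply: jones_projection_average.
Qed.
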